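(* Let $n\ge 2$ be a natural number. The assignment $R\mapsto K_0^n(R)$ determines a covariant functor from the category of rings and ring homomorphisms to the category of abelian groups and group homomorphisms.
   Context: Convention: all rings have a unit and all ring homomorphisms are unital. An $n$-potent in a ring $R$ is an element $e$ with $e^n=e$. For a ring $R$, let $M_\infty(R)=\bigcup_k M_k(R)$, the direct limit under $a\mapsto \mathrm{diag}(a,0)$, and let $\mathcal{P}^n_\infty(R)$ be the set of $n$-potents in $M_\infty(R)$. For $e,f\in\mathcal{P}^n_\infty(R)$ write $e\sim f$ if, for $k$ large enough that $e,f\in M_k(R)$, there are $a,b\in M_k(R)$ with $e=ab$ and $f=ba$. Let $\mathcal{V}^n(R)$ be the set of equivalence classes, an abelian monoid under $[e]+[f]=[\mathrm{diag}(e,f)]$ with identity $[0]$. The group $K_0^n(R)$ is the Grothendieck completion of $\mathcal{V}^n(R)$. On morphisms, a ring homomorphism $\alpha:R\to S$ is sent to the map induced by $[(a_{ij})]\mapsto[(\alpha(a_{ij}))]$. *)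

(* Defs.v *)
From HB Require Import structures.
From mathcomp Require Import all_boot all_order all_algebra.
From mathcomp Require Import boolp.

Set Implicit Arguments.
Unset Strict Implicit.
Unset Printing Implicit Defensive.

Import GRing.Theory.
Local Open Scope ring_scope.
Local Open Scope quotient_scope.

(* Rings are unital, possibly noncommutative and possibly zero ([pzRingType]);
   [{rmorphism R -> S}] preserves 1. *)

Section SwapEquivalence.
Variable R : pzRingType.

Definition swap_eq k l (A : 'M[R]_k) (B : 'M[R]_l) : Prop :=
  exists (a : 'M[R]_(k, l)) (b : 'M[R]_(l, k)), A = a *m b /\ B = b *m a.

Lemma swap_sym k l (A : 'M[R]_k) (B : 'M[R]_l) : swap_eq A B -> swap_eq B A.
Proof. by case=> a [b [-> ->]]; exists b, a. Qed.

Lemma mxpowSr k (A : 'M[R]_k) s : A ^+ s.+1 = A ^+ s *m A.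
Proof. exact: exprSr. Qed.

Lemma mulmx_pow k l (a : 'M[R]_(k, l)) (b : 'M[R]_(l, k)) s :
  (a *m b) ^+ s.+1 = a *m (b *m a) ^+ s *m b.
Proof.
elim: s => [|s IHs]; first by rewrite expr1 expr0 mulmx1.
by rewrite exprSr IHs exprSr -!mulmxE !mulmxA.
Qed.

Lemma swap_trans n k l m (A : 'M[R]_k) (B : 'M[R]_l) (C : 'M[R]_m) :
    (2 <= n)%N -> A ^+ n = A -> C ^+ n = C ->
  swap_eq A B -> swap_eq B C -> swap_eq A C.
Proof.
case: n => [|[|n]] // _ An Cn [a [b [Aab Bba]]] [c [d [Bcd Cdc]]].
exists (a *m c), ((d *m c) ^+ n *m d *m b); split.
  rewrite !mulmxA -[a *m c *m _](mulmxA a) -[a *m _ *m d](mulmxA a) -mulmx_pow.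
  by rewrite -Bcd Bba -mulmx_pow -Aab.
rewrite !mulmxA -[_ *m b *m a]mulmxA -Bba Bcd mulmxA -mulmxA -[RHS]mulmxA -!Cdc.
by rewrite mulmxA -(mulmxA (C ^+ n)) -Cdc !mulmxE -[in LHS]Cn !exprSr.
Qed.

Lemma swap_refl n k (A : 'M[R]_k) : (2 <= n)%N -> A ^+ n = A -> swap_eq A A.
Proof.
case: n => [|[|n]] // _ An; exists A, (A ^+ n.+1).
by rewrite !mulmxE -exprS -exprSr.
Qed.

Lemma swap_block k l k' l' (A : 'M[R]_k) (A' : 'M[R]_k')
    (B : 'M[R]_l) (B' : 'M[R]_l') :
  swap_eq A A' -> swap_eq B B' ->
  swap_eq (block_mx A 0 0 B) (block_mx A' 0 0 B').
Proof.
case=> a [b [-> ->]] [c [d [-> ->]]].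
exists (block_mx a 0 0 c), (block_mx b 0 0 d).
by rewrite !mulmx_block !mulmx0 !mul0mx !addr0 !add0r.
Qed.

Lemma block_pow k l (A : 'M[R]_k) (B : 'M[R]_l) s :
  (block_mx A 0 0 B) ^+ s = block_mx (A ^+ s) 0 0 (B ^+ s).
Proof.
elim: s => [|s IHs]; first by rewrite !expr0 -scalar_mx_block.
rewrite !exprS IHs -!mulmxE mulmx_block.
by rewrite !mulmx0 !mul0mx !addr0 !add0r.
Qed.

Lemma swap_blockC n k l (A : 'M[R]_k) (B : 'M[R]_l) :
    (2 <= n)%N -> A ^+ n = A -> B ^+ n = B ->
  swap_eq (block_mx A 0 0 B) (block_mx B 0 0 A).
Proof.
case: n => [|[|n]] // _ An Bn.
exists (block_mx 0 A B 0), (block_mx 0 (B ^+ n.+1) (A ^+ n.+1) 0).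
rewrite !mulmx_block !mulmx0 !mul0mx !addr0 !add0r !mulmxE -!exprS -!exprSr.
by rewrite An Bn.
Qed.

Lemma swap_castmx n k l (e : k = l) (A : 'M[R]_k) :
  (2 <= n)%N -> A ^+ n = A -> swap_eq A (castmx (e, e) A).
Proof. by case: l / e => n2 An; rewrite castmx_id; apply: swap_refl An. Qed.

Lemma swap_block0 n k l (A : 'M[R]_k) :
  (2 <= n)%N -> A ^+ n = A -> swap_eq (block_mx (0 : 'M[R]_l) 0 0 A) A.
Proof.
case: n => [|[|n]] // _ An.
exists (col_mx 0 A), (row_mx 0 (A ^+ n.+1)).
rewrite mul_col_row mul_row_col !mulmx0 !mul0mx add0r !mulmxE.
by rewrite -exprS -exprSr An.
Qed.

End SwapEquivalence.

(* The union M_oo(R) of the M_k(R) along a |-> diag(a, 0): matrices indexed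
   by nat x nat which vanish outside some k x k upper left corner. *)

Record Minf (R : pzRingType) := MkMinf {
  Minf_entry :> nat -> nat -> R;
  Minf_finite : exists k, forall i j : nat,
    (k <= i)%N || (k <= j)%N -> Minf_entry i j = 0 }.

Section Minf.
Variable R : pzRingType.
Implicit Types e f : Minf R.

(* e lies in M_k(R) *)
Definition in_M k e : Prop :=
  forall i j : nat, (k <= i)%N || (k <= j)%N -> e i j = 0.

Definition corner k l e : 'M[R]_(k, l) := \matrix_(i < k, j < l) e i j.

Definition mx_entry k l (A : 'M[R]_(k, l)) (i j : nat) : R :=
  if insub i is Some i' then if insub j is Some j' then A i' j' else 0 else 0.

Lemma mx_entry_finite k (A : 'M[R]_k) :
  exists m, forall i j : nat, (m <= i)%N || (m <= j)%N -> mx_entry A i j = 0.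
Proof.
exists k => i j; rewrite /mx_entry.
case: insubP => // i' ik _; case: insubP => // j' jk _.
by rewrite leqNgt ik leqNgt jk.
Qed.

(* the canonical inclusion of M_k(R) into M_oo(R) *)
Definition mx_inf k (A : 'M[R]_k) : Minf R := MkMinf (mx_entry_finite A).

Lemma Minf_ext e f : (forall i j, e i j = f i j) -> e = f.
Proof.
case: e f => [e he] [f hf] /= ef.
have {}ef : e = f by apply/funext => i; apply/funext => j.
by case: f / ef hf => hf; congr MkMinf; apply: Prop_irrelevance.
Qed.

Lemma mx_infE k (A : 'M[R]_k) (i j : 'I_k) : mx_inf A i j = A i j.
Proof. by rewrite /= /mx_entry !insubT //= => ? ?; congr (A _ _); apply/val_inj. Qed.

Lemma in_M_mx_inf k (A : 'M[R]_k) : in_M k (mx_inf A).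
Proof.
move=> i j; rewrite /= /mx_entry.
case: insubP => // i' ik _; case: insubP => // j' jk _.
by rewrite leqNgt ik leqNgt jk.
Qed.

Lemma corner_mx_inf k (A : 'M[R]_k) : corner k k (mx_inf A) = A.
Proof. by apply/matrixP => i j; rewrite mxE mx_infE. Qed.

Lemma mx_inf_corner k e : in_M k e -> mx_inf (corner k k e) = e.
Proof.
move=> ek; apply: Minf_ext => i j /=; rewrite /mx_entry.
case: insubP => [i' _ <-|]; last by rewrite -leqNgt => ki; rewrite ek ?ki.
case: insubP => [j' _ <-|]; last by rewrite -leqNgt => kj; rewrite ek ?kj ?orbT.
by rewrite mxE.
Qed.

Lemma in_M_le k m e : (k <= m)%N -> in_M k e -> in_M m e.
Proof.
by move=> km ek i j /orP[] /(leq_trans km) h; apply: ek; rewrite h ?orbT.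
Qed.

Definition diag1 m k : 'M[R]_(m, k) := \matrix_(i, j) ((i : nat) == j)%:R.

Lemma diag1_corner m k l e : in_M k e -> diag1 m k *m corner k l e = corner m l e.
Proof.
move=> ek; apply/matrixP => i j; rewrite !mxE.
have [ik|ki] := ltnP i k.
  rewrite (bigD1 (Ordinal ik)) //= !mxE eqxx mul1r big1 ?addr0 // => s.
  by rewrite -val_eqE /= => /negbTE si; rewrite !mxE eq_sym si mul0r.
rewrite ek ?ki // big1 // => s _; rewrite !mxE.
by rewrite gtn_eqF ?mul0r // (leq_trans (ltn_ord s)).
Qed.

Lemma corner_diag1 m k l e : in_M k e -> corner l k e *m diag1 k m = corner l m e.
Proof.
move=> ek; apply/matrixP => i j; rewrite !mxE.
have [jk|kj] := ltnP j k.
  rewrite (bigD1 (Ordinal jk)) //= !mxE eqxx mulr1 big1 ?addr0 // => s.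
  by rewrite -val_eqE /= => /negbTE sj; rewrite !mxE sj mulr0.
rewrite ek ?kj ?orbT // big1 // => s _; rewrite !mxE.
by rewrite ltn_eqF ?mulr0 // (leq_trans (ltn_ord s)).
Qed.

Lemma corner_pow k m e s : in_M k e -> in_M m e ->
  corner m m e ^+ s.+1 = diag1 m k *m corner k k e ^+ s.+1 *m diag1 k m.
Proof.
move=> ek em; elim: s => [|s IHs].
  by rewrite !expr1 diag1_corner // corner_diag1.
rewrite mxpowSr IHs [in RHS]mxpowSr -mulmxA diag1_corner //.
by rewrite -(corner_diag1 m k ek) !mulmxA.
Qed.

Lemma corner_potent n k m e : (2 <= n)%N -> in_M k e -> in_M m e ->
  corner k k e ^+ n = corner k k e -> corner m m e ^+ n = corner m m e.
Proof.
case: n => // n _ ek em en.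
by rewrite (corner_pow n ek em) en diag1_corner // corner_diag1.
Qed.

Lemma swap_corner n k m e : (2 <= n)%N -> in_M k e -> in_M m e ->
  corner k k e ^+ n = corner k k e -> swap_eq (corner m m e) (corner k k e).
Proof.
case: n => [|[|n]] // _ ek em en.
exists (diag1 m k *m corner k k e), (corner k k e ^+ n.+1 *m diag1 k m); split.
  rewrite mulmxA -(mulmxA (diag1 m k)) mulmxE -exprS en.
  by rewrite diag1_corner // corner_diag1.
by rewrite -mulmxA !diag1_corner // mulmxE -exprSr en.
Qed.

End Minf.

(* e ^ n = e is computed in any M_k(R) containing e, see [corner_potent]. *)
Definition is_potent n (R : pzRingType) (e : Minf R) : Prop :=
  exists2 k, in_M k e & corner k k e ^+ n = corner k k e.

Record potent n (R : pzRingType) := MkPotent {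
  potent_val :> Minf R;
  potentP : is_potent n potent_val }.

HB.instance Definition _ n R := gen_eqMixin (potent n R).
HB.instance Definition _ n R := gen_choiceMixin (potent n R).

Section Potents.
Variables (n : nat) (R : pzRingType).
Implicit Types e f g : potent n R.

Lemma potent_ext e f : potent_val e = potent_val f -> e = f.
Proof.
case: e f => [e he] [f hf] /= ef; case: f / ef hf => hf.
by congr MkPotent; apply: Prop_irrelevance.
Qed.

Lemma mx_inf_potent k (A : 'M[R]_k) : A ^+ n = A -> is_potent n (mx_inf A).
Proof. by move=> An; exists k; [exact: in_M_mx_inf|rewrite corner_mx_inf]. Qed.

Definition mx_potent k (A : 'M[R]_k) (An : A ^+ n = A) : potent n R :=
  MkPotent (mx_inf_potent An).

(* Any k with e and f in M_k(R) is allowed; [potent_equiv_ex] shows that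
   a single one suffices. *)
Definition potent_equiv e f : Prop :=
  forall k, in_M k e -> in_M k f -> exists a b : 'M[R]_k,
    corner k k e = a *m b /\ corner k k f = b *m a.

Hypothesis n_ge2 : (2 <= n)%N.

Lemma corner_potentP k e : in_M k e -> corner k k e ^+ n = corner k k e.
Proof. by case: (potentP e) => m em en ek; apply: corner_potent en. Qed.

Lemma potent_equivP k l e f : in_M k e -> in_M l f ->
  potent_equiv e f <-> swap_eq (corner k k e) (corner l l f).
Proof.
move=> ek fl.
have eP m : in_M m e -> corner m m e ^+ n = corner m m e by apply: corner_potentP.
have fP m : in_M m f -> corner m m f ^+ n = corner m m f by apply: corner_potentP.
split=> [ef|ef m em fm].
  have em := in_M_le (leq_maxl k l) ek; have fm := in_M_le (leq_maxr k l) fl.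
  apply: (swap_trans n_ge2 (eP _ ek) (fP _ fl) (swap_corner n_ge2 em ek (eP _ em))).
  apply: (swap_trans n_ge2 (eP _ em) (fP _ fl) (ef _ em fm)).
  exact: swap_corner n_ge2 fl fm (fP _ fl).
apply: (swap_trans n_ge2 (eP _ em) (fP _ fm) (swap_corner n_ge2 ek em (eP _ ek))).
apply: (swap_trans n_ge2 (eP _ ek) (fP _ fm) ef).
exact: swap_corner n_ge2 fm fl (fP _ fm).
Qed.

Lemma potent_equiv_ex e f :
  potent_equiv e f <-> exists k, [/\ in_M k e, in_M k f &
    exists a b : 'M[R]_k, corner k k e = a *m b /\ corner k k f = b *m a].
Proof.
case: (potentP e) (potentP f) => k ek _ [l fl _]; split=> [ef|].
  exists (maxn k l); have em := in_M_le (leq_maxl k l) ek.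
  by have fm := in_M_le (leq_maxr k l) fl; split=> //; apply: ef.
by case=> m [em fm ef]; apply/(potent_equivP em fm).
Qed.

Lemma potent_equiv_refl e : potent_equiv e e.
Proof. by move=> k ek _; apply: (swap_refl n_ge2); apply: corner_potentP. Qed.

Lemma potent_equiv_sym e f : potent_equiv e f -> potent_equiv f e.
Proof. by move=> ef k fk ek; apply: swap_sym; apply: ef. Qed.

Lemma potent_equiv_trans e f g :
  potent_equiv e f -> potent_equiv f g -> potent_equiv e g.
Proof.
case: (potentP e) (potentP f) (potentP g) => k ek ekn [l fl _] [m gm gmn].
move=> /(potent_equivP ek fl) ef /(potent_equivP fl gm) fg.
exact/(potent_equivP ek gm)/(swap_trans n_ge2 ekn gmn ef fg).
Qed.

Lemma mx_potent_equivP k l (A : 'M[R]_k) (B : 'M[R]_l)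
    (An : A ^+ n = A) (Bn : B ^+ n = B) :
  potent_equiv (mx_potent An) (mx_potent Bn) <-> swap_eq A B.
Proof.
have := @potent_equivP k l (mx_potent An) (mx_potent Bn).
by move=> /(_ (in_M_mx_inf A) (in_M_mx_inf B)); rewrite !corner_mx_inf.
Qed.

Lemma diag_potent k l (A : 'M[R]_k) (B : 'M[R]_l) :
  A ^+ n = A -> B ^+ n = B -> (block_mx A 0 0 B) ^+ n = block_mx A 0 0 B.
Proof. by move=> An Bn; rewrite block_pow An Bn. Qed.

End Potents.

Section Vn.
Variables (n : nat) (n_ge2 : (2 <= n)%N) (R : pzRingType).

Definition potent_equivb : rel (potent n R) := fun e f => `[< potent_equiv e f >].

Lemma potent_equivb_refl : reflexive potent_equivb.
Proof. by move=> e; apply/asboolP/potent_equiv_refl. Qed.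

Lemma potent_equivb_sym : symmetric potent_equivb.
Proof. by move=> e f; apply/asboolP/asboolP => /potent_equiv_sym. Qed.

Lemma potent_equivb_trans : transitive potent_equivb.
Proof.
move=> f e g /asboolP ef /asboolP fg; apply/asboolP.
exact: (potent_equiv_trans n_ge2 ef fg).
Qed.

Definition potent_equiv_rel : equiv_rel (potent n R) :=
  EquivRel potent_equivb potent_equivb_refl potent_equivb_sym potent_equivb_trans.

(* [n_ge2] is needed because ~ need not be transitive for n = 1. *)
Definition Vn : Type := {eq_quot potent_equiv_rel}.
HB.instance Definition _ := Choice.on Vn.

Definition Vn_class (e : potent n R) : Vn := \pi_({eq_quot potent_equiv_rel}) e.

Lemma Vn_classP e f : Vn_class e = Vn_class f <-> potent_equiv e f.
Proof.
by split=> [/eqmodP/asboolP //|ef]; apply/eqmodP/asboolP.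
Qed.

Definition Vn_mx k (A : 'M[R]_k) (An : A ^+ n = A) : Vn := Vn_class (mx_potent An).

Lemma Vn_mxP k l (A : 'M[R]_k) (B : 'M[R]_l) (An : A ^+ n = A) (Bn : B ^+ n = B) :
  Vn_mx An = Vn_mx Bn <-> swap_eq A B.
Proof. by rewrite Vn_classP mx_potent_equivP. Qed.

(* A size k with e in M_k(R), used to form diag(e, f); the class of the latter
   does not depend on it, see [Vn_addE]. *)
Definition potent_size (e : potent n R) : nat := projT1 (cid (Minf_finite e)).

Lemma in_M_potent_size e : in_M (potent_size e) e.
Proof. exact: projT2 (cid (Minf_finite e)). Qed.

Definition potent_mx (e : potent n R) : 'M[R]_(potent_size e) :=
  corner (potent_size e) (potent_size e) e.

Lemma potent_mx_pow e : potent_mx e ^+ n = potent_mx e.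
Proof. exact/(corner_potentP n_ge2)/in_M_potent_size. Qed.

Lemma Vn_mxK e : Vn_mx (potent_mx_pow e) = Vn_class e.
Proof.
by congr Vn_class; apply: potent_ext; apply/mx_inf_corner/in_M_potent_size.
Qed.

Lemma Vn_mx_surj (x : Vn) : exists k (A : 'M[R]_k) (An : A ^+ n = A), x = Vn_mx An.
Proof.
by exists _, _, (potent_mx_pow (repr x)); rewrite Vn_mxK /Vn_class reprK.
Qed.

Definition Vn_add (x y : Vn) : Vn :=
  Vn_mx (diag_potent (potent_mx_pow (repr x)) (potent_mx_pow (repr y))).

Lemma Vn_addE k l (A : 'M[R]_k) (B : 'M[R]_l) (An : A ^+ n = A) (Bn : B ^+ n = B) :
  Vn_add (Vn_mx An) (Vn_mx Bn) = Vn_mx (diag_potent An Bn).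
Proof.
by apply/Vn_mxP/swap_block; apply/(Vn_mxP (potent_mx_pow _));
  rewrite Vn_mxK /Vn_class reprK.
Qed.

Lemma potent0 : (0 : 'M[R]_0) ^+ n = 0.
Proof. by apply/matrixP => -[]. Qed.

Definition Vn_zero : Vn := Vn_mx potent0.

Lemma Vn_addA : associative Vn_add.
Proof.
move=> x y z; case: (Vn_mx_surj x) (Vn_mx_surj y) (Vn_mx_surj z).
move=> k [A [An ->]] [l [B [Bn ->]]] [m [C [Cn ->]]]; rewrite !Vn_addE.
apply/Vn_mxP/swap_sym.
have := @block_mxA R k l m k l m A 0 0 0 B 0 0 0 C.
rewrite /= !row_mx0 !col_mx0 => ->.
by apply: (swap_castmx _ n_ge2); rewrite !block_pow An Bn Cn.
Qed.

Lemma Vn_addC : commutative Vn_add.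
Proof.
move=> x y; case: (Vn_mx_surj x) (Vn_mx_surj y).
move=> k [A [An ->]] [l [B [Bn ->]]]; rewrite !Vn_addE.
exact/Vn_mxP/(swap_blockC n_ge2).
Qed.

Lemma Vn_add0 : left_id Vn_zero Vn_add.
Proof.
move=> x; case: (Vn_mx_surj x) => k [A [An ->]]; rewrite Vn_addE.
exact/Vn_mxP/(swap_block0 _ n_ge2).
Qed.

HB.instance Definition _ := GRing.isNmodule.Build Vn Vn_addA Vn_addC Vn_add0.

End Vn.

(* The Grothendieck completion of an abelian monoid. *)

Section Grothendieck.
Variable V : nmodType.

Definition groth_eqb : rel (V * V) := fun p q =>
  `[< exists z, p.1 + q.2 + z = q.1 + p.2 + z >].

Lemma groth_eqb_refl : reflexive groth_eqb.
Proof. by move=> p; apply/asboolP; exists 0. Qed.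

Lemma groth_eqb_sym : symmetric groth_eqb.
Proof. by move=> p q; apply/asboolP/asboolP => -[z h]; exists z. Qed.

Lemma groth_eqb_trans : transitive groth_eqb.
Proof.
move=> q p r /asboolP[z pq] /asboolP[t qr]; apply/asboolP.
exists (q.2 + z + t).
rewrite !addrA [LHS](ACl ((1*3*4)*(2*5))) /= pq !addrA.
rewrite [LHS](ACl ((1*4*5)*(2*3))) /= qr !addrA.
by rewrite [LHS](ACl (1*4*2*5*3)).
Qed.

Definition groth_eq_rel : equiv_rel (V * V) :=
  EquivRel groth_eqb groth_eqb_refl groth_eqb_sym groth_eqb_trans.

Definition groth : Type := {eq_quot groth_eq_rel}.
HB.instance Definition _ := Choice.on groth.

(* The class of (x, y), i.e. the formal difference x - y. *)
Definition groth_sub (x y : V) : groth := \pi_({eq_quot groth_eq_rel}) (x, y).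

Lemma groth_subP x y x' y' :
  groth_sub x y = groth_sub x' y' <-> exists z, x + y' + z = x' + y + z.
Proof. by split=> [/eqmodP/asboolP //|h]; apply/eqmodP/asboolP. Qed.

Lemma groth_sub_repr (u : groth) : groth_sub (repr u).1 (repr u).2 = u.
Proof. by rewrite /groth_sub -surjective_pairing reprK. Qed.

Definition groth_add (u v : groth) : groth :=
  groth_sub ((repr u).1 + (repr v).1) ((repr u).2 + (repr v).2).

Definition groth_opp (u : groth) : groth := groth_sub (repr u).2 (repr u).1.

Lemma groth_addE x y x' y' :
  groth_add (groth_sub x y) (groth_sub x' y') = groth_sub (x + x') (y + y').
Proof.
rewrite /groth_add; set p := repr _; set q := repr _.
have /groth_subP[z pz] : groth_sub p.1 p.2 = groth_sub x y by apply: groth_sub_repr.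
have /groth_subP[t qt] : groth_sub q.1 q.2 = groth_sub x' y' by apply: groth_sub_repr.
apply/groth_subP; exists (z + t).
rewrite !addrA [LHS](ACl ((1*3*5)*(2*4*6))) /= pz qt !addrA.
by rewrite [LHS](ACl (1*4*2*5*3*6)).
Qed.

Lemma groth_oppE x y : groth_opp (groth_sub x y) = groth_sub y x.
Proof.
rewrite /groth_opp; set p := repr _.
have /groth_subP[z pz] : groth_sub p.1 p.2 = groth_sub x y by apply: groth_sub_repr.
by apply/groth_subP; exists z; rewrite (addrC p.2) (addrC y).
Qed.

Lemma groth_addA : associative groth_add.
Proof.
move=> u v w; rewrite -(groth_sub_repr u) -(groth_sub_repr v) -(groth_sub_repr w).
by rewrite !groth_addE !addrA.
Qed.

Lemma groth_addC : commutative groth_add.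
Proof.
move=> u v; rewrite -(groth_sub_repr u) -(groth_sub_repr v) !groth_addE.
by rewrite (addrC (repr u).1) (addrC (repr u).2).
Qed.

Lemma groth_add0 : left_id (groth_sub 0 0) groth_add.
Proof. by move=> u; rewrite -(groth_sub_repr u) groth_addE !add0r. Qed.

Lemma groth_addN : left_inverse (groth_sub 0 0) groth_opp groth_add.
Proof.
move=> u; rewrite -(groth_sub_repr u) groth_oppE groth_addE.
by apply/groth_subP; exists 0; rewrite !addr0 add0r addrC.
Qed.

HB.instance Definition _ :=
  GRing.isZmodule.Build groth groth_addA groth_addC groth_add0 groth_addN.

Definition groth_of (x : V) : groth := groth_sub x 0.

Lemma groth_of_is_additive : nmod_morphism groth_of.
Proof.
split=> // x y; rewrite /groth_of; apply: esym.
by rewrite [LHS]groth_addE addr0.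
Qed.

HB.instance Definition _ := Algebra.isNmodMorphism.Build V groth groth_of
  groth_of_is_additive.

Lemma groth_subE x y : groth_sub x y = groth_of x - groth_of y.
Proof.
apply: esym; change (groth_add (groth_sub x 0) (groth_opp (groth_sub y 0)) = groth_sub x y).
by rewrite groth_oppE groth_addE addr0 add0r.
Qed.

End Grothendieck.

Definition K0 n (n_ge2 : (2 <= n)%N) (R : pzRingType) : zmodType :=
  groth (Vn n_ge2 R).

Record category := Category {
  obj :> Type;
  hom : obj -> obj -> Type;
  idm : forall x, hom x x;
  compm : forall x y z, hom y z -> hom x y -> hom x z;
  compm1f : forall x y (f : hom x y), compm (idm y) f = f;
  compmf1 : forall x y (f : hom x y), compm f (idm x) = f;
  compmA : forall x y z t (h : hom z t) (g : hom y z) (f : hom x y),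
    compm h (compm g f) = compm (compm h g) f }.

Record is_functor (C D : category) (F0 : C -> D)
    (F1 : forall x y, hom x y -> hom (F0 x) (F0 y)) : Prop := IsFunctor {
  functor_id : forall x, F1 _ _ (idm x) = idm (F0 x);
  functor_comp : forall x y z (g : hom y z) (f : hom x y),
    F1 _ _ (compm g f) = compm (F1 _ _ g) (F1 _ _ f) }.

Lemma rmorphism_ext (R S : pzRingType) (f g : {rmorphism R -> S}) : f =1 g -> f = g.
Proof.
case: f g => [f [[hf] [hf']]] [g [[hg] [hg']]] /= /funext fg.
case: g / fg hg hg' => hg hg'.
by rewrite (Prop_irrelevance hf hg) (Prop_irrelevance hf' hg').
Qed.

Lemma additive_ext (A B : zmodType) (f g : {additive A -> B}) : f =1 g -> f = g.
Proof.
case: f g => [f [[hf]]] [g [[hg]]] /= /funext fg.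
by case: g / fg hg => hg; rewrite (Prop_irrelevance hf hg).
Qed.

Definition ring_cat : category :=
  @Category pzRingType (fun R S => {rmorphism R -> S})
    (fun R => idfun) (fun R S T g f => g \o f)
    (fun R S f => @rmorphism_ext _ _ (idfun \o f) f (frefl f))
    (fun R S f => @rmorphism_ext _ _ (f \o idfun) f (frefl f))
    (fun R S T U h g f => @rmorphism_ext _ _ (h \o (g \o f)) (h \o g \o f)
      (frefl (h \o (g \o f)))).

Definition ab_cat : category :=
  @Category zmodType (fun A B => {additive A -> B})
    (fun A => idfun) (fun A B C g f => g \o f)
    (fun A B f => @additive_ext _ _ (idfun \o f) f (frefl f))
    (fun A B f => @additive_ext _ _ (f \o idfun) f (frefl f))
    (fun A B C D h g f => @additive_ext _ _ (h \o (g \o f)) (h \o g \o f)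
      (frefl (h \o (g \o f)))).

Section Induced.
Variables (R S : pzRingType) (alpha : {rmorphism R -> S}).

Lemma Minf_map_finite (e : Minf R) :
  exists k, forall i j : nat, (k <= i)%N || (k <= j)%N -> alpha (e i j) = 0.
Proof. by case: (Minf_finite e) => k ek; exists k => i j /ek ->; apply: rmorph0. Qed.

Definition Minf_map (e : Minf R) : Minf S := MkMinf (Minf_map_finite e).

Lemma potent_map_subproof n (e : potent n R) : is_potent n (Minf_map e).
Proof.
case: (potentP e) => k ek en; exists k => [i j /ek /= ->|]; first exact: rmorph0.
have -> : corner k k (Minf_map e) = map_mx alpha (corner k k e).
  by apply/matrixP => i j; rewrite !mxE.
by rewrite -rmorphXn en.
Qed.

Definition potent_map n (e : potent n R) : potent n S :=
  MkPotent (potent_map_subproof e).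

Variables (n : nat) (n_ge2 : (2 <= n)%N).

(* The maps V^n(R) -> V^n(S) and K_0^n(R) -> K_0^n(S) induced by
   [(a_ij)] |-> [(alpha(a_ij))]. *)
Definition Vn_induced (h : {additive Vn n_ge2 R -> Vn n_ge2 S}) : Prop :=
  forall e : potent n R, h (Vn_class n_ge2 e) = Vn_class n_ge2 (potent_map e).

Definition K0_induced (g : {additive K0 n_ge2 R -> K0 n_ge2 S}) : Prop :=
  exists2 h : {additive Vn n_ge2 R -> Vn n_ge2 S}, Vn_induced h &
    forall x, g (groth_of x) = groth_of (h x).

End Induced.

(* Main.v *)
Require Import Defs.
From mathcomp Require Import all_boot all_order all_algebra.
From HB Require Import structures.
From mathcomp Require Import boolp.

(** The relation e ~ f is witnessed by two matrix equations e = ab and f = ba,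
    which survive the entrywise application of a ring homomorphism alpha; hence
    alpha induces a map V^n(R) -> V^n(S) ([Vn_map]).  It is additive because
    alpha sends diag(A, B) to diag(alpha A, alpha B), and it extends to the
    Grothendieck completions by their universal property ([groth_map]).

    Functoriality is then deduced from uniqueness.  Every element of K_0^n(R)
    is a difference of classes of n-potents, so the requirement
    [(a_ij)] |-> [(alpha(a_ij))] determines a group homomorphism on K_0^n(R)
    ([K0_induced_unique]).  The identity fulfils this requirement for
    alpha = id ([K0_induced_id]), and a composite of induced maps fulfils it for
    the composite ring homomorphism ([K0_induced_comp]), so these are the maps
    that the functor must assign. *)

Set Implicit Arguments.
Unset Strict Implicit.
Unset Printing Implicit Defensive.

Import GRing.Theory.
Local Open Scope ring_scope.
Local Open Scope quotient_scope.

Lemma groth_subD (V : nmodType) (x y x' y' : V) :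
  groth_sub x y + groth_sub x' y' = groth_sub (x + x') (y + y').
Proof. exact: groth_addE. Qed.

Lemma Vn_mxD n (n_ge2 : (2 <= n)%N) (R : pzRingType) k l
    (A : 'M[R]_k) (B : 'M[R]_l) (An : A ^+ n = A) (Bn : B ^+ n = B) :
  Vn_mx n_ge2 An + Vn_mx n_ge2 Bn = Vn_mx n_ge2 (diag_potent An Bn).
Proof. exact: Vn_addE. Qed.

Section GrothendieckMap.
Variables V W : nmodType.

Lemma groth_additive_ext (A : zmodType) (f g : {additive groth V -> A}) :
  (forall x, f (groth_of x) = g (groth_of x)) -> f = g.
Proof.
move=> fg; apply: additive_ext => u.
by rewrite -(groth_sub_repr u) groth_subE !raddfB !fg.
Qed.

Variable h : {additive V -> W}.

Definition groth_map (u : groth V) : groth W :=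
  groth_sub (h (repr u).1) (h (repr u).2).

Lemma groth_map_sub x y : groth_map (groth_sub x y) = groth_sub (h x) (h y).
Proof.
rewrite /groth_map; set p := repr _.
have /groth_subP[z pz] : groth_sub p.1 p.2 = groth_sub x y.
  exact: groth_sub_repr.
by apply/groth_subP; exists (h z); rewrite -!raddfD pz.
Qed.

Lemma groth_map_is_additive : nmod_morphism groth_map.
Proof.
split=> [|u v]; first by rewrite [LHS]groth_map_sub raddf0.
rewrite -(groth_sub_repr u) -(groth_sub_repr v) groth_subD.
by rewrite !groth_map_sub groth_subD !raddfD.
Qed.

HB.instance Definition _ := Algebra.isNmodMorphism.Build (groth V) (groth W)
  groth_map groth_map_is_additive.

Lemma groth_map_of x : groth_map (groth_of x) = groth_of (h x).
Proof. by rewrite groth_map_sub raddf0. Qed.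

End GrothendieckMap.

Section InducedMap.
Variables (n : nat) (n_ge2 : (2 <= n)%N).
Variables (R S : pzRingType) (alpha : {rmorphism R -> S}).

Lemma corner_Minf_map k l (e : Minf R) :
  corner k l (Minf_map alpha e) = map_mx alpha (corner k l e).
Proof. by apply/matrixP => i j; rewrite !mxE. Qed.

Lemma in_M_Minf_map k (e : Minf R) : in_M k e -> in_M k (Minf_map alpha e).
Proof. by move=> ek i j /ek /= ->; apply: rmorph0. Qed.

(** The image of e under alpha may lie in a smaller M_k than e does, so ~ is
    transported in one M_k containing e and f, which [potent_equiv_ex] allows. *)
Lemma potent_map_equiv (e f : potent n R) :
  potent_equiv e f -> potent_equiv (potent_map alpha e) (potent_map alpha f).
Proof.
move=> /(potent_equiv_ex n_ge2)[k [ek fk [a [b [eab fba]]]]].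
apply/(potent_equiv_ex n_ge2); exists k.
split; [exact: in_M_Minf_map|exact: in_M_Minf_map|].
exists (map_mx alpha a), (map_mx alpha b).
by rewrite !corner_Minf_map eab fba !map_mxM.
Qed.

Definition Vn_map (x : Vn n_ge2 R) : Vn n_ge2 S :=
  Vn_class n_ge2 (potent_map alpha (repr x)).

Lemma Vn_map_class (e : potent n R) :
  Vn_map (Vn_class n_ge2 e) = Vn_class n_ge2 (potent_map alpha e).
Proof.
apply/Vn_classP/potent_map_equiv/(Vn_classP n_ge2).
by rewrite /Vn_class reprK.
Qed.

Lemma map_mx_potent k (A : 'M[R]_k) :
  A ^+ n = A -> map_mx alpha A ^+ n = map_mx alpha A.
Proof. by move=> An; rewrite -rmorphXn An. Qed.

Lemma Vn_map_mx k (A : 'M[R]_k) (An : A ^+ n = A) :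
  Vn_map (Vn_mx n_ge2 An) = Vn_mx n_ge2 (map_mx_potent An).
Proof.
rewrite Vn_map_class; congr Vn_class; apply: potent_ext => /=.
rewrite -(mx_inf_corner (in_M_Minf_map (in_M_mx_inf A))).
by rewrite corner_Minf_map corner_mx_inf.
Qed.

Lemma Vn_map_is_additive : nmod_morphism Vn_map.
Proof.
split=> [|x y].
  rewrite [LHS]Vn_map_mx; apply/Vn_mxP; rewrite map_mx0.
  exact: swap_refl n_ge2 (potent0 n S).
case: (Vn_mx_surj x) (Vn_mx_surj y) => k [A [An ->]] [l [B [Bn ->]]].
rewrite Vn_mxD !Vn_map_mx Vn_mxD.
apply/Vn_mxP; rewrite map_block_mx !map_mx0.
by apply: (swap_refl n_ge2); apply: diag_potent; apply: map_mx_potent.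
Qed.

HB.instance Definition _ := Algebra.isNmodMorphism.Build
  (Vn n_ge2 R) (Vn n_ge2 S) Vn_map Vn_map_is_additive.

Definition K0_map : {additive K0 n_ge2 R -> K0 n_ge2 S} := groth_map Vn_map.

Lemma K0_map_induced : K0_induced alpha K0_map.
Proof.
by exists Vn_map => [e|x]; [exact: Vn_map_class|exact: groth_map_of].
Qed.

Lemma K0_induced_unique (f g : {additive K0 n_ge2 R -> K0 n_ge2 S}) :
  K0_induced alpha f -> K0_induced alpha g -> f = g.
Proof.
move=> [h hP fh] [h' h'P gh]; apply: groth_additive_ext => x.
rewrite fh gh; have [k [A [An ->]]] := Vn_mx_surj x.
by rewrite [h _]hP [h' _]h'P.
Qed.

End InducedMap.

Lemma K0_induced_id n (n_ge2 : (2 <= n)%N) (R : pzRingType) :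
  K0_induced (idfun : {rmorphism R -> R})
    (idfun : {additive K0 n_ge2 R -> K0 n_ge2 R}).
Proof.
exists idfun => // e /=.
by congr Vn_class; apply/potent_ext/Minf_ext.
Qed.

Lemma K0_induced_comp n (n_ge2 : (2 <= n)%N) (R S T : pzRingType)
    (beta : {rmorphism S -> T}) (alpha : {rmorphism R -> S})
    (g : {additive K0 n_ge2 S -> K0 n_ge2 T})
    (f : {additive K0 n_ge2 R -> K0 n_ge2 S}) :
  K0_induced beta g -> K0_induced alpha f -> K0_induced (beta \o alpha) (g \o f).
Proof.
move=> [h' h'P gh'] [h hP fh]; exists (h' \o h) => [e|x] /=; last by rewrite fh gh'.
by rewrite hP h'P; congr Vn_class; apply/potent_ext/Minf_ext.
Qed.

Theorem proposition3p5 (n : nat) (n_ge2 : (2 <= n)%N) :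
  exists F1 : forall R S : pzRingType,
      {rmorphism R -> S} -> {additive K0 n_ge2 R -> K0 n_ge2 S},
    unique (fun G => forall (R S : pzRingType) (alpha : {rmorphism R -> S}),
                       K0_induced alpha (G R S alpha)) F1
    /\ @is_functor ring_cat ab_cat (K0 n_ge2) F1.
Proof.
have K0P := K0_map_induced n_ge2.
exists (K0_map n_ge2); split; [split=> // G GP|split=> [R|R S T beta alpha]].
- apply: functional_extensionality_dep => R.
  apply: functional_extensionality_dep => S.
  by apply/funext => alpha; apply: K0_induced_unique (K0P _ _ _) (GP _ _ _).
- exact: K0_induced_unique (K0P _ _ _) (K0_induced_id n_ge2 R).
- exact: K0_induced_unique (K0P _ _ _) (K0_induced_comp (K0P _ _ _) (K0P _ _ _)).
Qed.
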